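(* Let $P\in\mathcal{F}^{n\times m}$ be a causal plant. Then the following statements are equivalent: (i) The plant $P$ is stabilizable. (ii) The $\mathcal{A}$-modules $\mathcal{T}_P$ and $\mathcal{W}_P$ are projective. (iii) The set of all generalized elementary factors of $P$ generates $\mathcal{A}$; that is, $$\sum_{I\in\mathcal{I}}\Lambda_{PI}=\mathcal{A}.$$
   Context: $\mathcal{A}$ is a commutative ring with identity $1\neq 0$ (the set of stable causal transfer functions), and $\mathcal{F}=\mathcal{F}(\mathcal{A})=\{n/d\mid n,d\in\mathcal{A},\ d \text{ a nonzerodivisor}\}$ is its total ring of fractions. An element $x$ is a zerodivisor if $xy=0$ for some $y\neq 0$, and a nonzerodivisor otherwise. $m,n$ are positive integers; a plant is a matrix $P\in\mathcal{F}^{n\times m}$. $E_k$ is the identity matrix of size $k$; $(\cdot)^t$ is transpose. A square matrix over $\mathcal{A}$ is nonsingular if its determinant is a nonzerodivisor of $\mathcal{A}$; its inverse is then taken over $\mathcal{F}$. Causality: fix a prime ideal $\mathcal{Z}$ of $\mathcal{A}$, $\mathcal{Z}\neq\mathcal{A}$, containing all zerodivisors of $\mathcal{A}$. A matrix over $\mathcal{F}$ is causal if each of its entries lies in $\mathcal{P}=\{n/d\in\mathcal{F}\mid n\in\mathcal{A},\ d\in\mathcal{A}\setminus\mathcal{Z}\}$. Stabilizability: for $P\in\mathcal{F}^{n\times m}$ and $C\in\mathcal{F}^{m\times n}$ such that $\det(E_n+PC)$ is a unit of $\mathcal{F}$, put $$H(P,C)=\begin{pmatrix}(E_n+PC)^{-1}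 & -P(E_m+CP)^{-1}\\ C(E_n+PC)^{-1} & (E_m+CP)^{-1}\end{pmatrix}.$$ $P$ is stabilizable if there is $C\in\mathcal{F}^{m\times n}$ such that $\det(E_n+PC)$ is a unit of $\mathcal{F}$ and all entries of $H(P,C)$ lie in $\mathcal{A}$; such a $C$ is called a stabilizing controller of $P$. Modules: write $P=ND^{-1}=\widetilde{D}^{-1}\widetilde{N}$ with $N,D,\widetilde{N},\widetilde{D}$ matrices over $\mathcal{A}$ and $D,\widetilde{D}$ nonsingular. $\mathcal{T}_P$ is the $\mathcal{A}$-module generated by the rows of the $(n+m)\times m$ matrix $\begin{pmatrix}N\\ D\end{pmatrix}$, and $\mathcal{W}_P$ is the $\mathcal{A}$-module generated by the columns of the $n\times(m+n)$ matrix $\begin{pmatrix}\widetilde{N}&\widetilde{D}\end{pmatrix}$. These are determined up to isomorphism, independently of the chosen fractions. Generalized elementary factors: $\mathcal{I}$ is the set of all sets of $m$ distinct integers between $1$ and $m+n$. For $I=\{i_1<\cdots<i_m\}\in\mathcal{I}$, $\Delta_I$ is the $m\times(m+n)$ matrix whose $(k,i_k)$-entry is $1$ for $k=1,\dots,m$ and whose other entries are $0$. With $P=ND^{-1}$ ($N,D$ over $\mathcal{A}$, $D$ nonsingular) and $T=\begin{pmatrix}N\\ D\end{pmatrix}$, the generalized elementary factor of $P$ with respect to $I$ is the ideal $$\Lambda_{PI}=\{\lambda\in\mathcal{A}\mid \exists K\in\mathcal{A}^{(m+n)\times m}:\ \lambda T=K\Delta_I T\}$$ of $\mathcal{A}$;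 it does not depend on the choice of $N$ and $D$. *)

(* Defs.v *)
From HB Require Import structures.
From mathcomp Require Import all_boot all_order all_algebra.
From mathcomp Require Import boolp classical_sets.

Set Implicit Arguments.
Unset Strict Implicit.
Unset Printing Implicit Defensive.

Import GRing.Theory.
Local Open Scope ring_scope.

Definition zerodivisor (A : comNzRingType) (x : A) : Prop :=
  exists y : A, y != 0 /\ x * y = 0.

Definition nonzerodivisor (A : comNzRingType) (x : A) : Prop :=
  ~ zerodivisor x.

(* MathComp's {fraction _} requires an integral domain, so the total ring of
   fractions of A is described as an extension phi : A -> F; these conditions
   determine (F, phi) up to unique isomorphism. *)
Record is_total_fraction_ring (A : comNzRingType) (F : comUnitRingType)
    (phi : {rmorphism A -> F}) : Prop := IsTotalFractionRing {
  total_fraction_inj : injective phi;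
  total_fraction_unit :
    forall d : A, nonzerodivisor d -> phi d \is a GRing.unit;
  total_fraction_surj :
    forall x : F, exists a d : A, nonzerodivisor d /\ x = phi a / phi d
}.

Definition causal (A : comNzRingType) (F : comUnitRingType)
    (phi : {rmorphism A -> F}) (Z : prime_idealr A) (p q : nat)
    (M : 'M[F]_(p, q)) : Prop :=
  forall i j, exists a d : A, d \notin Z /\ M i j = phi a / phi d.

Definition feedback_mx (F : comUnitRingType) (n m : nat)
    (P : 'M[F]_(n, m)) (C : 'M[F]_(m, n)) : 'M[F]_(n + m) :=
  block_mx (invmx (1%:M + P *m C))        (- (P *m invmx (1%:M + C *m P)))
           (C *m invmx (1%:M + P *m C))   (invmx (1%:M + C *m P)).

(* Since det (1 + CP) = det (1 + PC), every inverse occurring in feedback_mx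
   is a genuine one. *)
Definition stabilizing_controller (A : comNzRingType) (F : comUnitRingType)
    (phi : {rmorphism A -> F}) (n m : nat)
    (P : 'M[F]_(n, m)) (C : 'M[F]_(m, n)) : Prop :=
  \det (1%:M + P *m C) \is a GRing.unit /\
  (forall i j, exists a : A, feedback_mx P C i j = phi a).

Definition stabilizable (A : comNzRingType) (F : comUnitRingType)
    (phi : {rmorphism A -> F}) (n m : nat) (P : 'M[F]_(n, m)) : Prop :=
  exists C : 'M[F]_(m, n), stabilizing_controller phi P C.

Definition nonsingular (A : comNzRingType) (k : nat) (D : 'M[A]_k) : Prop :=
  nonzerodivisor (\det D).

Definition right_fraction (A : comNzRingType) (F : comUnitRingType)
    (phi : {rmorphism A -> F}) (n m : nat) (P : 'M[F]_(n, m))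
    (N : 'M[A]_(n, m)) (D : 'M[A]_m) : Prop :=
  nonsingular D /\ P = map_mx phi N *m invmx (map_mx phi D).

Definition left_fraction (A : comNzRingType) (F : comUnitRingType)
    (phi : {rmorphism A -> F}) (n m : nat) (P : 'M[F]_(n, m))
    (N : 'M[A]_(n, m)) (D : 'M[A]_n) : Prop :=
  nonsingular D /\ P = invmx (map_mx phi D) *m map_mx phi N.

Definition in_span (A : comNzRingType) (V : lmodType A) (k : nat)
    (x : 'I_k -> V) : {pred V} :=
  fun v => `[< exists c : 'I_k -> A, v = \sum_i c i *: x i >].

Fact in_span_submod_closed (A : comNzRingType) (V : lmodType A) (k : nat)
  (x : 'I_k -> V) : submod_closed (in_span x).
Proof.
split=> [|a u v /asboolP[c ->] /asboolP[d ->]]; apply/asboolP.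
  by exists (fun=> 0); rewrite big1 // => i _; rewrite scale0r.
exists (fun i => a * c i + d i); rewrite scaler_sumr -big_split /=.
by apply: eq_bigr => i _; rewrite scalerDl scalerA.
Qed.

HB.instance Definition _ (A : comNzRingType) (V : lmodType A) (k : nat)
    (x : 'I_k -> V) :=
  GRing.isSubmodClosed.Build A V (in_span x) (in_span_submod_closed x).

(* The submodule generated by the family x, as an A-module in its own right. *)
Record span_of (A : comNzRingType) (V : lmodType A) (k : nat)
    (x : 'I_k -> V) := SpanOf {
  span_val :> V;
  span_valP : span_val \in in_span x
}.

HB.instance Definition _ (A : comNzRingType) (V : lmodType A) (k : nat)
    (x : 'I_k -> V) := [isSub for @span_val A V k x].
HB.instance Definition _ (A : comNzRingType) (V : lmodType A) (k : nat)
    (x : 'I_k -> V) := [Choice of span_of x by <:].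
HB.instance Definition _ (A : comNzRingType) (V : lmodType A) (k : nat)
    (x : 'I_k -> V) := [SubChoice_isSubZmodule of span_of x by <:].
HB.instance Definition _ (A : comNzRingType) (V : lmodType A) (k : nat)
    (x : 'I_k -> V) := [SubZmodule_isSubLmodule of span_of x by <:].

Definition projective_module (A : comNzRingType) (M : lmodType A) : Prop :=
  forall (X Y : lmodType A) (f : {linear X -> Y}) (g : {linear M -> Y}),
    (forall y : Y, exists x : X, f x = y) ->
    exists h : {linear M -> X}, forall u : M, f (h u) = g u.

Definition row_module (A : comNzRingType) (k m : nat) (T : 'M[A]_(k, m))
  : lmodType A := span_of (fun i => row i T).

Definition col_module (A : comNzRingType) (n k : nat) (W : 'M[A]_(n, k))
  : lmodType A := span_of (fun j => col j W).

(* enum I lists I in increasing order, so its item of index k is the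
   (k+1)-st smallest element of I. *)
Definition selection_mx (A : comNzRingType) (n m : nat)
    (I : {set 'I_(n + m)}) : 'M[A]_(m, n + m) :=
  \matrix_(k < m, j < n + m) (onth (enum I) k == Some j)%:R.

Definition gen_elementary_factor (A : comNzRingType) (n m : nat)
    (N : 'M[A]_(n, m)) (D : 'M[A]_m) (I : {set 'I_(n + m)}) : set A :=
  [set l : A | exists K : 'M[A]_(n + m, m),
     l *: col_mx N D = K *m selection_mx A I *m col_mx N D]%classic.

Definition ideal_sum (A : comNzRingType) (J : finType) (S : {pred J})
    (L : J -> set A) : set A :=
  [set a : A | exists l : J -> A,
     (forall j, j \in S -> L j (l j)) /\ a = \sum_(j in S) l j]%classic.

(* Main.v *)
Require Import Defs.
From HB Require Import structures.
From mathcomp Require Import all_boot all_order all_algebra.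
From mathcomp Require Import perm boolp classical_sets ring_quotient.

Set Implicit Arguments.
Unset Strict Implicit.
Unset Printing Implicit Defensive.

Import GRing.Theory.
Local Open Scope ring_scope.

(** Everything is read off the graph of [P], the image of [graph_mx P], which
    is the block column of [P] over the identity.  All three conditions say
    that some projection of [F^(n+m)] onto this graph has its entries in [A]
    ([graph_splits phi P 1]).

    A stabilizing controller [C] gives such a projection, along the graph of
    [- C]; up to signs and a summand 1 it is the feedback matrix
    ([stabilizable_splits]).  Conversely a projection gives a left inverse
    [row_mx X Y] of [graph_mx P], and [invmx Y *m X] is a stabilizing controller
    whenever [Y] is invertible over [F].  Causality allows the projection to be
    moved until this holds: on the line joining it to the projection of the
    zero controller, the points whose parameter is a power of a denominator
    of [P] outside [Z] are still over [A], and the determinant of [Y], a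
    polynomial in the parameter with value 1 at 1, cannot lie in [Z] at all of
    them ([splits_stabilizable], [prime_power_avoids_roots]).

    By the dual basis lemma ([projective_spanP]) a projection over [A] makes
    the row module projective, and its complement makes the column module
    projective.  A dual basis of the row module is in turn a projection
    onto the graph ([row_projective_splits]).

    By the Cauchy-Binet formula the principal [m]-minors of the projection,
    an idempotent of rank [m], have sum 1, and a power of each lies in
    a generalized elementary factor ([splits_ideal_sum]).  Conversely, each
    element of a generalized elementary factor gives, up to a power, a
    projection defined over [A] after multiplication by that power; as
    elements with sum 1 have powers that generate the unit ideal, these
    combine to a projection over [A] ([ideal_sum_splits]). *)

(** * Ideals *)

(** Ideals are kept as propositional predicates, because the ideals below are
    given by existential conditions. *)
Definition ideal_axiom (A : comNzRingType) (I : A -> Prop) : Prop :=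
  [/\ I 0, forall a b, I a -> I b -> I (a + b) & forall a b, I b -> I (a * b)].

Lemma ideal_sum_in (A : comNzRingType) (I : A -> Prop) (J : Type) (r : seq J)
    (S : pred J) (l : J -> A) :
  ideal_axiom I -> (forall j, S j -> I (l j)) -> I (\sum_(j <- r | S j) l j).
Proof. by case=> I0 ID _; apply: big_ind. Qed.

(** An element with a power in [I] is nilpotent modulo [I], and sums of nilpotents
    are nilpotent by the binomial formula; so 1, being a sum of such elements,
    is nilpotent modulo [I].  This allows every local argument below to prove
    its claim only up to a fixed power of the local denominator. *)
Lemma ideal1_of_powers (A : comNzRingType) (I : A -> Prop) (J : finType)
    (S : pred J) (l : J -> A) (k : nat) :
  ideal_axiom I -> \sum_(j | S j) l j = 1 ->
  (forall j, S j -> I (l j ^+ k)) -> I 1.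
Proof.
move=> I_ideal suml lI; have [I0 ID IM] := I_ideal.
suff [N]: exists N, I ((\sum_(j | S j) l j) ^+ N) by rewrite suml expr1n.
apply: (big_ind (fun x => exists N, I (x ^+ N))) => [|x y [p Ip] [q Iq]|j Sj].
- by exists 1; rewrite expr1.
- exists (p + q)%N; rewrite exprDn; apply: ideal_sum_in => // i _.
  rewrite -mulr_natl; apply/IM.
  case: (leqP q i) => [le_qi|/ltnW le_iq].
    by rewrite -(subnK le_qi) exprD mulrA; apply: IM.
  rewrite mulrC -(subnK (_ : p <= p + q - i)%N) ?exprD ?mulrA; first exact: IM.
  by rewrite -addnBA // leq_addr.
- by exists k; apply: lI.
Qed.

Lemma ideal_sum_ideal (A : comNzRingType) (J : finType) (S : {pred J})
    (L : J -> set A) :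
  (forall j, ideal_axiom (L j)) -> ideal_axiom (ideal_sum S L).
Proof.
move=> L_ideal; split=> [|a b [la [laL ->]] [lb [lbL ->]]|a b [lb [lbL ->]]].
- by exists (fun=> 0); rewrite big1; split=> // j _; case: (L_ideal j).
- exists (fun j => la j + lb j); rewrite big_split; split=> // j Sj.
  by case: (L_ideal j) => _ LD _; apply: LD; [apply: laL|apply: lbL].
- exists (fun j => a * lb j); rewrite big_distrr; split=> // j Sj.
  by case: (L_ideal j) => _ _; apply; apply: lbL.
Qed.

Lemma ideal_sum_sub (A : comNzRingType) (J : finType) (S : {pred J})
    (L : J -> set A) (j : J) (a : A) :
  (forall j, ideal_axiom (L j)) -> j \in S -> L j a -> ideal_sum S L a.
Proof.
move=> L_ideal Sj La; exists (fun i => if i == j then a else 0).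
split=> [i _|]; first by case: eqP => [->//|_]; case: (L_ideal i).
by rewrite (bigD1 j) //= eqxx big1 ?addr0 // => i /andP[_ /negbTE->].
Qed.

(** * Matrices over a commutative ring *)

Lemma inj_map_mx (aT rT : Type) (f : aT -> rT) (p q : nat) :
  injective f -> injective (map_mx f : 'M_(p, q) -> 'M_(p, q)).
Proof.
move=> f_inj X Y /matrixP XY; apply/matrixP => i j; apply: f_inj.
by have := XY i j; rewrite !mxE.
Qed.

Lemma mulmx_sum_col (R : comNzRingType) (p q : nat) (W : 'M[R]_(p, q))
    (v : 'rV[R]_q) : \sum_i v 0 i *: col i W = W *m v^T.
Proof.
apply: trmx_inj; rewrite trmx_mul trmxK mulmx_sum_row linear_sum /=.
by apply: eq_bigr => i _; rewrite linearZ /= tr_col.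
Qed.

(** Replaces the cancellation available for [a = 1], or for [a] a nonzerodivisor:
    [S] and [M] may have zerodivisor determinants, and conjugating by the
    adjugate of [S] costs the factor [\det S * \det M = a ^+ k]. *)
Lemma scalar_mulmxC (R : comNzRingType) (k : nat) (a : R) (S M : 'M[R]_k) :
  S *m M = a%:M -> a ^+ k *: (M *m S) = (a ^+ k.+1)%:M.
Proof.
move=> SM; have detSM : \det S * \det M = a ^+ k by rewrite -det_mulmx SM det_scalar.
have detS : \det S *: (M *m S) = (a * \det S)%:M.
  rewrite -mul_scalar_mx -mul_adj_mx -!mulmxA [S *m (M *m S)]mulmxA SM.
  by rewrite mul_scalar_mx -scalemxAr mul_adj_mx scale_scalar_mx.
rewrite -detSM mulrC -scalerA detS scale_scalar_mx mulrCA exprS -detSM.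
by rewrite [\det S * _]mulrC.
Qed.

(** The increasing enumeration of [I]; the default [x0] is harmless as long as
    [I] has [m] elements. *)
Definition set_item (p m : nat) (x0 : 'I_p) (I : {set 'I_p}) (k : 'I_m) : 'I_p :=
  nth x0 (enum I) k.

Lemma set_item_inj (p m : nat) (x0 : 'I_p) (I : {set 'I_p}) :
  #|I| = m -> injective (@set_item p m x0 I).
Proof.
move=> cI i j /eqP; rewrite nth_uniq ?enum_uniq -?cardE ?cI ?ltn_ord //.
by move/eqP/val_inj.
Qed.

(** Expanding both the product and the determinant gives a sum over all functions
    [f] from the columns to the indices; non-injective ones have two equal rows
    and vanish, and the injective ones with image [I] are the increasing
    enumeration of [I] composed with the permutations, which rebuilds
    the determinant of the columns of [X] in [I]. *)
Lemma cauchy_binet (R : comNzRingType) (m p : nat) (x0 : 'I_p)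
    (X : 'M[R]_(m, p)) (S : 'M[R]_(p, m)) :
  \det (X *m S) =
  \sum_(I : {set 'I_p} | #|I| == m)
     \det (colsub (set_item x0 I) X) * \det (rowsub (set_item x0 I) S).
Proof.
transitivity (\sum_(f : {ffun 'I_m -> 'I_p})
    (\prod_i X i (f i)) * \det (rowsub f S)).
  pose XS s i j := X i j * S j (s i).
  transitivity (\sum_(f : {ffun 'I_m -> 'I_p}) \sum_(s : 'S_m)
      (-1) ^+ s * \prod_i XS s i (f i)).
    rewrite exchange_big; apply: eq_bigr => /= s _; rewrite -big_distrr /=.
    congr (_ * _); rewrite -(bigA_distr_bigA (XS s)) /=.
    by apply: eq_bigr => i _; rewrite mxE.
  apply: eq_bigr => f _; rewrite big_distrr /=; apply: eq_bigr => s _.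
  rewrite mulrCA big_split //=; congr (_ * (_ * _)).
  by apply: eq_bigr => i _; rewrite mxE.
rewrite (bigID (fun f : {ffun 'I_m -> 'I_p} => injectiveb f)) /= addrC.
rewrite big1 ?add0r => [|f /injectivePn[i1 [i2 Di12 Ef12]]]; last first.
  rewrite (determinant_alternate Di12) ?mulr0 // => j.
  by rewrite !mxE Ef12.
rewrite (partition_big (fun f : {ffun 'I_m -> 'I_p} => f @: 'I_m)
   (fun I => #|I| == m)) /=; last first.
  by move=> f /injectiveP f_inj; rewrite card_imset // card_ord.
apply: eq_bigr => I /eqP cI; set e := set_item x0 I.
have e_inj : injective e by apply: set_item_inj.
pose h (s : 'S_m) := [ffun i => e (s i)].
have h_inj : injective h.
  move=> s t /ffunP st; apply/permP => i; apply: e_inj.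
  by have := st i; rewrite !ffunE.
(* Injective functions with image [I] are the [e \o s], [s] a permutation. *)
rewrite (eq_bigl (fun f => f \in h @: 'S_m)) => [|f]; last first.
  apply/andP/imsetP => [[/injectiveP f_inj /eqP fI]|[s _ ->]]; last first.
    split; first by apply/injectiveP => i j; rewrite !ffunE => /e_inj/perm_inj.
    apply/eqP/setP => x; apply/imsetP/idP => [[i _ ->]|xI].
      by rewrite ffunE -mem_enum mem_nth // -cardE cI.
    have xe : (index x (enum I) < m)%N.
      by rewrite -[X in (_ < X)%N]cI cardE index_mem mem_enum.
    exists ((s^-1)%g (Ordinal xe)) => //.
    by rewrite ffunE permKV /e /set_item /= nth_index ?mem_enum.
  have fe i : (index (f i) (enum I) < m)%N.
    by rewrite -[X in (_ < X)%N]cI cardE index_mem mem_enum -fI imset_f.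
  have fI' i : f i \in enum I by rewrite mem_enum -fI imset_f.
  have g_inj : injective (fun i => Ordinal (fe i)).
    move=> i j [] /(congr1 (nth x0 (enum I))).
    by rewrite !nth_index // => /f_inj.
  exists (perm g_inj) => //; apply/ffunP => i.
  by rewrite ffunE permE /e /set_item /= nth_index.
rewrite big_imset /=; last by move=> s t _ _ /h_inj.
rewrite [\det (colsub _ _)]/(\det _) big_distrl /=; apply: eq_big => // s _.
rewrite [RHS]mulrAC mulrC; congr (_ * _).
  have -> : rowsub (h s) S = row_perm s (rowsub e S).
    by apply/matrixP => i j; rewrite !mxE ffunE.
  by rewrite row_permE det_mulmx det_perm.
by apply: eq_bigr => i _; rewrite mxE ffunE.
Qed.

(** * Polynomial values modulo a prime ideal *)

Lemma horner_factor (A : comNzRingType) (f : {poly A}) (x : A) :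
  exists2 q : {poly A}, (size q <= (size f).-1)%N &
    forall y, f.[y] = (y - x) * q.[y] + f.[x].
Proof.
have : root (f - f.[x]%:P) x by rewrite rootE !hornerE subrr.
case/factor_theorem => q fE; exists q => [|y]; last first.
  apply/eqP; rewrite -subr_eq; apply/eqP.
  by have := congr1 (horner^~ y) fE; rewrite !hornerE mulrC.
have [->|q0] := eqVneq q 0; first by rewrite size_poly0.
have sq : (size q).+1 = size (f - f.[x]%:P).
  by rewrite fE size_Mmonic ?monicXsubC // size_XsubC addn2.
have [f0|f0] := eqVneq f 0.
  by move: sq; rewrite f0 horner0 polyC0 subr0 size_poly0.
rewrite -ltnS prednK ?lt0n ?size_poly_eq0 // sq.
apply: leq_trans (size_polyD _ _) _; rewrite geq_max leqnn size_polyN.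
by rewrite (leq_trans (size_polyC_leq1 _)) // lt0n size_poly_eq0.
Qed.

(** A nonzero polynomial over a domain has at most as many roots as its degree,
    read modulo the prime [Z] without forming the quotient domain: the points
    [xs] are pairwise distinct modulo [Z] and too many, so [f] vanishes
    modulo [Z] everywhere. *)
Lemma horner_in_prime (A : comNzRingType) (Z : prime_idealr A)
    (xs : seq A) (f : {poly A}) (y : A) :
  pairwise (fun x x' => x' - x \notin Z) xs -> (size f <= size xs)%N ->
  all (fun x => f.[x] \in Z) xs -> f.[y] \in Z.
Proof.
elim: xs f => [|x xs IHxs] f /=.
  by rewrite leqn0 size_poly_eq0 => _ /eqP->; rewrite horner0 idealr0.
case/andP => x_xs xs_Z f_xs /andP[fx fxs].
have [q q_xs fE] := horner_factor f x.
rewrite fE rpredD // idealMr // IHxs //.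
  by rewrite (leq_trans q_xs) // -subn1 leq_subLR add1n.
apply/allP => x' xs_x'; move/allP/(_ _ xs_x'): fxs; rewrite fE rpredDr //.
by rewrite prime_idealrM (negbTE (allP x_xs _ xs_x')).
Qed.

(** If the powers of [d] are distinct modulo [Z], there are too many of them to
    all be roots of [f] modulo [Z].  If two of them agree, some positive power
    of [d] is 1 modulo [Z], where [f] does not vanish.  The dichotomy covers
    finite and infinite residue domains at once. *)
Lemma prime_power_avoids_roots (A : comNzRingType) (Z : prime_idealr A)
    (d : A) (f : {poly A}) :
  d \notin Z -> f.[1] \notin Z -> exists j, f.[d ^+ j.+1] \notin Z.
Proof.
move=> dZ f1; apply: contrapT => /forallNP f_in'.
have f_in j : f.[d ^+ j.+1] \in Z by apply: contraT => /(f_in' j).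
have dXZ i : d ^+ i \notin Z.
  by elim: i => [|i IHi]; rewrite ?idealr1 // exprS prime_idealrM negb_or dZ.
case/negP: (f1); apply: (@horner_in_prime _ _ [seq d ^+ j.+1 | j <- iota 0 (size f)]).
- apply/(pairwiseP 0) => i j; rewrite !inE size_map size_iota => ltif ltjf lt_ij.
  rewrite !(nth_map 0) ?size_iota // !nth_iota // !add0n.
  apply/negP => dijZ; case/negP: f1.
  have [q _ fE] := horner_factor f (d ^+ (j - i)).
  rewrite fE rpredDr; last by rewrite -(subnSK lt_ij) f_in.
  rewrite mulrC idealMr // -opprB rpredN.
  suff: d ^+ i.+1 * (d ^+ (j - i) - 1) \in Z.
    by rewrite prime_idealrM (negbTE (dXZ _)).
  by rewrite mulrBr mulr1 -exprD addSn subnKC // ltnW.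
- by rewrite size_map size_iota.
- by apply/allP => _ /mapP[j _ ->].
Qed.

(** * Projectivity of finitely generated submodules *)

Lemma span_val_sum (A : comNzRingType) (V : lmodType A) (k l : nat)
    (x : 'I_k -> V) (c : 'I_l -> A) (u : 'I_l -> span_of x) :
  span_val (\sum_i c i *: u i) = \sum_i c i *: span_val (u i).
Proof.
rewrite -[LHS]/((val : {linear span_of x -> V}) _) linear_sum.
by apply: eq_bigr => i _; rewrite linearZ.
Qed.

(** The dual basis lemma: the covering of the span by the free module has a section
    exactly when the coordinates of the section on the generators form a
    matrix [Q] that fixes the generators and kills their relations. *)
Lemma projective_spanP (A : comNzRingType) (V : lmodType A) (k : nat)
    (x : 'I_k -> V) :
  projective_module (span_of x) <->
  exists Q : 'M[A]_k,
    (forall i, \sum_j Q i j *: x j = x i) /\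
    (forall c : 'rV[A]_k, \sum_i c 0 i *: x i = 0 -> c *m Q = 0).
Proof.
split=> [proj|[Q [Qx kerQ]]]; last first.
  move=> X Y f g f_surj.
  have xP i : x i \in in_span x.
    by apply/asboolP; exists (Q i); rewrite Qx.
  pose y i := SpanOf (xP i).
  have /choice[z fz] : forall i, exists z, f z = g (y i) by move=> i; apply: f_surj.
  have /choice[c uc] : forall u : span_of x, exists c : 'rV[A]_k,
      u = \sum_i c 0 i *: y i.
    case=> v vP; have /asboolP[c vE] := vP; exists (\row_i c i).
    apply: val_inj; rewrite /= span_val_sum {1}vE.
    by apply: eq_bigr => i _; rewrite mxE.
  (* The chosen coordinates [c u] are not linear in [u]; [c u *m Q] is, since [Q]
     kills the ambiguity. *)
  pose h0 (u : span_of x) := \sum_i (c u *m Q) 0 i *: z i.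
  have yker (b : 'rV[A]_k) : \sum_i b 0 i *: y i = 0 -> b *m Q = 0.
    by move=> /(congr1 (@span_val _ _ _ x)); rewrite span_val_sum => /kerQ.
  have h0_lin : linear h0.
    move=> a u v; rewrite /h0 scaler_sumr -big_split /=.
    have /eqP : (c (a *: u + v) - a *: c u - c v) *m Q = 0.
      apply: yker; transitivity (\sum_i c (a *: u + v) 0 i *: y i -
          a *: (\sum_i c u 0 i *: y i) - \sum_i c v 0 i *: y i); last first.
        by rewrite -!uc addrAC addrK subrr.
      rewrite scaler_sumr -!sumrB.
      by apply: eq_bigr => i _; rewrite !mxE !scalerBl scalerA.
    rewrite !mulmxBl -addrA -opprD subr_eq0 => /eqP ->.
    by apply: eq_bigr => i _; rewrite -scalemxAl !mxE scalerDl scalerA.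
  pose h : {linear span_of x -> X} :=
    HB.pack h0 (GRing.isLinear.Build _ _ _ _ h0 h0_lin).
  exists h => u; rewrite /h /= /h0 raddf_sum /=.
  under eq_bigr => i _ do rewrite linearZ /= fz -linearZ /=.
  rewrite -raddf_sum; congr (g _); rewrite {2}(uc u).
  under eq_bigr => i _ do rewrite mxE scaler_suml.
  rewrite exchange_big; apply: eq_bigr => i _ /=.
  under eq_bigr => j _ do rewrite -scalerA.
  rewrite -scaler_sumr; congr (_ *: _); apply: val_inj => /=.
  by rewrite span_val_sum /= Qx.
pose comb (c : 'rV[A]_k) := \sum_i c 0 i *: x i.
have combP c : comb c \in in_span x by apply/asboolP; exists (c 0).
pose f0 c := SpanOf (combP c).
have f0_lin : linear f0.
  move=> a u v; apply: val_inj; rewrite linearP /= /comb scaler_sumr -big_split.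
  by apply: eq_bigr => i _; rewrite !mxE scalerDl scalerA.
pose f : {linear 'rV[A]_k -> span_of x} :=
  HB.pack f0 (GRing.isLinear.Build _ _ _ _ f0 f0_lin).
have f_surj y : exists c, f c = y.
  case: y => v vP; have /asboolP[c vE] := vP; exists (\row_i c i).
  by apply: val_inj; rewrite /= /comb vE; apply: eq_bigr => i _; rewrite mxE.
have [s fs'] := proj _ _ f (idfun : {linear span_of x -> span_of x}) f_surj.
have fs u : f (s u) = u := fs' u.
pose y i := f (delta_mx 0 i).
have yE i : val (y i) = x i.
  rewrite /y /= /comb (bigD1 i) //= mxE !eqxx scale1r big1 ?addr0 // => j ij.
  by rewrite mxE (negbTE ij) andbF scale0r.
exists (\matrix_i s (y i)); split=> [i|c c0].
  rewrite -[RHS]yE -(fs (y i)) /= /comb.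
  by apply: eq_bigr => j _; rewrite mxE.
have fc0 : f c = 0 by apply: val_inj.
rewrite mulmx_sum_row -[RHS](linear0 s) -fc0 {2}(row_sum_delta c) linear_sum.
rewrite linear_sum; apply: eq_bigr => i _.
by rewrite rowK !linearZ.
Qed.

(** * Projections onto the graph of a plant *)

Definition graph_mx (F : comUnitRingType) (n m : nat) (P : 'M[F]_(n, m)) :
  'M[F]_(n + m, m) := col_mx P 1%:M.

(** The elements [a] for which [a] times a projection onto the graph of [P] is
    defined over [A].  Any map [graph_mx P *m X] that restricts to [a] on the
    graph determines [X] as its lower block, so [Q] carries all the data. *)
Definition graph_splits (A : comNzRingType) (F : comUnitRingType)
    (phi : {rmorphism A -> F}) (n m : nat) (P : 'M[F]_(n, m)) (a : A) : Prop :=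
  exists Q : 'M[A]_(n + m),
    graph_mx P *m map_mx phi (dsubmx Q) = map_mx phi Q /\
    map_mx phi (dsubmx Q) *m graph_mx P = (phi a)%:M.

Lemma graph_splits_ideal (A : comNzRingType) (F : comUnitRingType)
    (phi : {rmorphism A -> F}) (n m : nat) (P : 'M[F]_(n, m)) :
  ideal_axiom (graph_splits phi P).
Proof.
split=> [|a b [Qa [GQa QGa]] [Qb [GQb QGb]]|a b [Q [GQ QG]]].
- by exists 0; rewrite !linear0 !map_mx0 mulmx0 mul0mx rmorph0 raddf0.
- exists (Qa + Qb); rewrite linearD /= !map_mxD mulmxDr mulmxDl GQa GQb QGa QGb.
  by rewrite rmorphD raddfD.
- exists (a *: Q); rewrite linearZ /= !map_mxZ -scalemxAr -scalemxAl GQ QG.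
  by rewrite rmorphM scale_scalar_mx.
Qed.

(** A right fraction is a change of basis: the columns of [N] over [D] span, over
    [F], the graph of [P]. *)
Lemma graph_fraction (A : comNzRingType) (F : comUnitRingType)
    (phi : {rmorphism A -> F}) (n m : nat) (P : 'M[F]_(n, m))
    (N : 'M[A]_(n, m)) (D : 'M[A]_m) :
  is_total_fraction_ring phi -> right_fraction phi P N D ->
  map_mx phi D \in unitmx /\
  map_mx phi (col_mx N D) = graph_mx P *m map_mx phi D.
Proof.
move=> F_frac [D_nz ->].
have D_unit : map_mx phi D \in unitmx.
  by rewrite unitmxE det_map_mx; apply: total_fraction_unit.
by split=> //; rewrite mul_col_mx mul1mx mulmxKV // map_col_mx.
Qed.

(** * Projections and stabilizing controllers *)

(** The projection onto the graph of [P] along the graph of the controller,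
    [graph_mx P *m invmx (1 + C P) *m row_mx C 1], is the feedback matrix up
    to signs and the summand 1 in the upper left block.  Its kernel is the
    graph of [- C]. *)
Lemma stabilizable_splits (A : comNzRingType) (F : comUnitRingType)
    (phi : {rmorphism A -> F}) (n m : nat) (P : 'M[F]_(n, m)) :
  stabilizable phi P -> graph_splits phi P 1.
Proof.
case=> C [PC_unit H_stable].
have /choice[M0 M0E] : forall i, exists r : 'rV[A]_(n + m),
    row i (feedback_mx P C) = map_mx phi r.
  move=> i; have /choice[r rE] := H_stable i.
  by exists (\row_j r j); apply/rowP => j; rewrite mxE rE !mxE.
pose M : 'M[A]_(n + m) := \matrix_i M0 i.
have ME : feedback_mx P C = map_mx phi M.
  by apply/row_matrixP => i; rewrite M0E -map_row rowK.
move: ME; rewrite /feedback_mx -[M]submxK map_block_mx.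
set U := invmx (1%:M + P *m C); set V := invmx (1%:M + C *m P).
case/eq_block_mx => ulE urE dlE drE.
have PC_unitmx : 1%:M + P *m C \in unitmx by rewrite unitmxE.
have UE : U + P *m C *m U = 1%:M by rewrite -[X in X + _]mul1mx -mulmxDl mulmxV.
(* The push-through identity: [1 - C U P] inverts [1 + C P]. *)
have CP_unitmx : 1%:M + C *m P \in unitmx.
  suff /mulmx1_unit[] : (1%:M + C *m P) *m (1%:M - C *m U *m P) = 1%:M by [].
  rewrite mulmxBr mulmx1 mulmxDl mul1mx.
  have -> : C *m P *m (C *m U *m P) = C *m P - C *m U *m P.
    rewrite -{3}[C]mulmx1 -UE mulmxDr mulmxDl addrAC subrr add0r.
    by rewrite !mulmxA.
  by rewrite [X in _ - X]addrC subrK addrK.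
have VC : V *m C = C *m U.
  apply: (can_inj (mulKmx CP_unitmx)); rewrite mulKVmx // mulmxA.
  rewrite mulmxDl mul1mx -mulmxA -[X in X + _]mulmx1 -mulmxDr.
  by rewrite -mulmxA mulmxV // mulmx1.
exists (block_mx (1%:M - ulsubmx M) (- ursubmx M) (dlsubmx M) (drsubmx M)).
rewrite block_mxEv col_mxKd map_row_mx -dlE -drE map_col_mx !map_row_mx.
rewrite map_mxB map_mxN map_mx1 -ulE -urE -dlE -drE opprK.
rewrite mul_col_mx mul1mx !mul_mx_row mulmxA -[X in X - U]UE addrAC subrr add0r.
split=> //; rewrite /graph_mx mul_row_col mulmx1 -VC -mulmxA.
by rewrite -[X in _ + X]mulmx1 -mulmxDr addrC mulVmx // rmorph1.
Qed.

(** Every left inverse [row_mx X Y] of [graph_mx P] with [Y] invertible comes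
    from the controller [invmx Y *m X], and its projection is the one attached
    to that controller. *)
Lemma feedback_mx_of_split (F : comUnitRingType) (n m : nat)
    (P : 'M[F]_(n, m)) (X : 'M[F]_(m, n)) (Y : 'M[F]_m) :
  Y \in unitmx -> X *m P + Y = 1%:M ->
  let C := invmx Y *m X in
  1%:M + P *m C \in unitmx /\
  feedback_mx P C = block_mx (1%:M - P *m X) (- (P *m Y)) X Y.
Proof.
move=> Y_unit XY C.
have CP : 1%:M + C *m P = invmx Y.
  by rewrite -(mulVmx Y_unit) -mulmxA -mulmxDr addrC XY mulmx1.
have CX : C = X + C *m P *m X.
  by rewrite -[X in X + _]mul1mx -mulmxDl CP.
have inv : (1%:M + P *m C) *m (1%:M - P *m X) = 1%:M.
  rewrite mulmxBr mulmx1 mulmxDl mul1mx -[P *m C *m _]mulmxA -mulmxDr.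
  by rewrite mulmxA -CX addrK.
have [PC_unit _] := mulmx1_unit inv; split=> //.
have U : invmx (1%:M + P *m C) = 1%:M - P *m X.
  by apply: (can_inj (mulKmx PC_unit)); rewrite mulmxV.
by rewrite /feedback_mx U CP invmxK mulmxBr mulmx1 mulmxA {1}CX addrK.
Qed.

Lemma causal_denominator (A : comNzRingType) (F : comUnitRingType)
    (phi : {rmorphism A -> F}) (Z : prime_idealr A) (n m : nat)
    (P : 'M[F]_(n, m)) :
  (forall d, d \notin Z -> phi d \is a GRing.unit) -> causal phi Z P ->
  exists (d : A) (M : 'M[A]_(n, m)), d \notin Z /\ phi d *: P = map_mx phi M.
Proof.
move=> Z_unit P_causal.
have /choice[a /choice[d dP]] : forall ij : 'I_n * 'I_m, exists a, exists d,
    d \notin Z /\ P ij.1 ij.2 = phi a / phi d by case=> i j; apply: P_causal.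
exists (\prod_ij d ij).
exists (\matrix_(i, j) (a (i, j) * \prod_(kl | kl != (i, j)) d kl)); split.
  apply: (big_ind (fun x => x \notin Z)) => [|x y xZ yZ|ij _].
  - by rewrite idealr1.
  - by rewrite prime_idealrM negb_or xZ.
  - by case: (dP ij).
apply/matrixP => i j; have [dZ /= Pij] := dP (i, j); rewrite !mxE Pij.
rewrite (bigD1 (i, j)) //= !rmorphM mulrC mulrA; congr (_ * _).
by rewrite mulrVK // Z_unit.
Qed.

(** The left inverse [row_mx X Y] given by a projection [Q] need not have [Y]
    invertible.  The trivial left inverse [row_mx 0 1] does, but its projection
    has the block [P], which is only integral after multiplication by some [d]
    outside [Z].  On the line joining the two, at the parameter [t], the block
    [Y] is [(1 - t) Qd + t], where [Qd] is the lower right block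
    of [Q], and the projection is over [A] as soon as [t] is a multiple
    of [d].  The determinant of [Y] is 1 at [t = 1], so it stays
    outside [Z] at some positive power of [d]; elements outside [Z] are units
    of [F]. *)
Lemma splits_stabilizable (A : comNzRingType) (F : comUnitRingType)
    (phi : {rmorphism A -> F}) (Z : prime_idealr A) (n m : nat)
    (P : 'M[F]_(n, m)) :
  (forall d, d \notin Z -> phi d \is a GRing.unit) -> causal phi Z P ->
  graph_splits phi P 1 -> stabilizable phi P.
Proof.
move=> Z_unit P_causal [Q [GQ QG]].
have [d [M [dZ dP]]] := causal_denominator Z_unit P_causal.
pose Qd := drsubmx Q.
pose f := \det (map_mx polyC Qd + 'X *: map_mx polyC (1%:M - Qd)).
have fE t : f.[t] = \det (Qd + t *: (1%:M - Qd)).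
  rewrite -horner_evalE -det_map_mx; congr (\det _); apply/matrixP => i j.
  by rewrite !mxE /= /horner_eval !hornerE.
have f1 : f.[1] \notin Z by rewrite fE scale1r addrC subrK det1 idealr1.
have [j] := prime_power_avoids_roots dZ f1.
set t := d ^+ j.+1; rewrite fE; set Y := _ + _ => YZ.
(* One factor [d] of [t] clears the denominators of [P]. *)
have tP : phi t *: P = map_mx phi (d ^+ j *: M).
  by rewrite /t exprSr rmorphM -scalerA dP map_mxZ.
have Y_unit : map_mx phi Y \in unitmx by rewrite unitmxE det_map_mx Z_unit.
pose X := (1 - t) *: dlsubmx Q.
move: GQ QG; rewrite -[Q]submxK block_mxEv col_mxKd map_row_mx -block_mxEv.
rewrite map_block_mx mul_col_mx mul1mx mul_mx_row [LHS]block_mxEv.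
case/eq_block_mx => PQl PQr _ _; rewrite mul_row_col mulmx1 rmorph1 => QG.
have YE : Y = (1 - t) *: Qd + t%:M.
  by rewrite /Y scalerBr scale_scalar_mx mulr1 scalerBl scale1r addrCA addrC.
have XY : map_mx phi X *m P + map_mx phi Y = 1%:M.
  rewrite YE map_mxD !map_mxZ map_scalar_mx -scalemxAl addrA -scalerDr QG.
  by rewrite rmorphB rmorph1 scale_scalar_mx mulr1 -raddfD subrK.
have [PC_unit HE] := feedback_mx_of_split Y_unit XY.
exists (invmx (map_mx phi Y) *m map_mx phi X); split; first by rewrite -unitmxE.
suff [H HM] : exists H : 'M[A]_(n + m),
    feedback_mx P (invmx (map_mx phi Y) *m map_mx phi X) = map_mx phi H.
  by move=> k l; exists (H k l); rewrite HM mxE.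
exists (block_mx (1%:M - (1 - t) *: ulsubmx Q)
                 (- ((1 - t) *: ursubmx Q + d ^+ j *: M)) X Y).
rewrite HE map_block_mx map_mxB map_mx1 map_mxN.
rewrite [map_mx phi ((1 - t) *: ursubmx Q + _)]map_mxD -tP !map_mxZ.
rewrite -PQl -PQr YE map_mxD !map_mxZ map_scalar_mx mulmxDr -!scalemxAr.
by rewrite mul_mx_scalar.
Qed.

(** * Projections and projective modules *)

(** The projection itself is a dual basis matrix for the rows of [col_mx N D]:
    it fixes them, and a relation between them is a relation between the rows of
    [graph_mx P]. *)
Lemma splits_row_projective (A : comNzRingType) (F : comUnitRingType)
    (phi : {rmorphism A -> F}) (n m : nat) (P : 'M[F]_(n, m))
    (N : 'M[A]_(n, m)) (D : 'M[A]_m) :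
  is_total_fraction_ring phi -> right_fraction phi P N D ->
  graph_splits phi P 1 -> projective_module (row_module (col_mx N D)).
Proof.
move=> F_frac P_right [Q [GQ QG]].
have phi_inj := total_fraction_inj F_frac.
have [D_unit TE] := graph_fraction F_frac P_right.
set T := col_mx N D in TE *.
apply/projective_spanP; exists Q; split=> [i|c].
  suff QT : Q *m T = T.
    by rewrite -{2}QT row_mul mulmx_sum_row; apply: eq_bigr => j _; rewrite mxE.
  apply: (inj_map_mx phi_inj); rewrite map_mxM TE -GQ.
  rewrite -[_ *m _ *m (_ *m _)]mulmxA [map_mx _ (dsubmx Q) *m _]mulmxA.
  by rewrite QG rmorph1 mul1mx.
rewrite -mulmx_sum_row => cT; apply: (inj_map_mx phi_inj).
rewrite map_mxM -GQ mulmxA map_mx0.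
suff -> : map_mx phi c *m graph_mx P = 0 by rewrite mul0mx.
apply: (can_inj (mulmxK D_unit)).
by rewrite -mulmxA -TE -map_mxM cT map_mx0 mul0mx.
Qed.

(** A dual basis matrix [Q] kills the relations between the rows of
    [col_mx N D].  Since [D] is nonsingular, Cramer's rule writes [\det D]
    times any row as a combination of the rows of [D]; these relations
    determine [Q] from its lower rows and force it to be a projection onto
    the graph. *)
Lemma row_projective_splits (A : comNzRingType) (F : comUnitRingType)
    (phi : {rmorphism A -> F}) (n m : nat) (P : 'M[F]_(n, m))
    (N : 'M[A]_(n, m)) (D : 'M[A]_m) :
  is_total_fraction_ring phi -> right_fraction phi P N D ->
  projective_module (row_module (col_mx N D)) -> graph_splits phi P 1.
Proof.
move=> F_frac P_right /projective_spanP[Q [QT kerQ]].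
have phi_inj := total_fraction_inj F_frac.
have [D_unit TE] := graph_fraction F_frac P_right.
set T := col_mx N D in TE QT kerQ *.
have {}QT : Q *m T = T.
  apply/row_matrixP => i; rewrite -[RHS]QT row_mul mulmx_sum_row.
  by apply: eq_bigr => j _; rewrite mxE.
have {}kerQ (p : nat) (c : 'M[A]_(p, n + m)) : c *m T = 0 -> c *m Q = 0.
  move=> cT; apply/row_matrixP => i; rewrite row_mul row0; apply: kerQ.
  by rewrite -mulmx_sum_row -row_mul cT row0.
have lowT : map_mx phi (dsubmx Q) *m graph_mx P = 1%:M.
  apply: (can_inj (mulmxK D_unit)); rewrite -mulmxA -TE mul1mx -map_mxM.
  by rewrite mul_dsub_mx QT col_mxKd.
exists Q; split; last by rewrite rmorph1.
(* The rows of [c] are the relations given by Cramer's rule. *)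
have dQ : \det D *: Q = T *m \adj D *m dsubmx Q.
  pose c : 'M[A]_(n + m) := (\det D)%:M - T *m \adj D *m row_mx 0 1%:M.
  have /kerQ : c *m T = 0.
    rewrite mulmxBl mul_scalar_mx -[X in _ - X]mulmxA mul_row_col mul0mx add0r.
    by rewrite mul1mx -mulmxA mul_adj_mx mul_mx_scalar subrr.
  rewrite mulmxBl mul_scalar_mx -[X in _ - X]mulmxA -{2}[Q]vsubmxK mul_row_col.
  by rewrite mul0mx add0r mul1mx => /eqP; rewrite subr_eq0 => /eqP.
have d_unit : (phi (\det D))%:M \in @unitmx F (n + m).
  by rewrite unitmxE det_scalar unitrX // -det_map_mx -unitmxE.
apply: (can_inj (mulKmx d_unit)); rewrite !mul_scalar_mx -[RHS]map_mxZ dQ.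
rewrite !map_mxM TE -!mulmxA [map_mx phi D *m _]mulmxA -map_mxM mul_mx_adj.
by rewrite map_scalar_mx mul_scalar_mx -scalemxAr.
Qed.

(** The columns of [row_mx Nt Dt] generate, up to an isomorphism over [F], the
    image of [A^(n+m)] in the cokernel of the graph, so the complementary
    projection [1 - Q] does the work.  In the proof [Q'] is [1 - Q] conjugated by
    the matrix with blocks 0, 1, -1, 0, which turns [row_mx 1 (- P)],
    whose kernel is the graph, into [row_mx P 1]. *)
Lemma splits_col_projective (A : comNzRingType) (F : comUnitRingType)
    (phi : {rmorphism A -> F}) (n m : nat) (P : 'M[F]_(n, m))
    (Nt : 'M[A]_(n, m)) (Dt : 'M[A]_n) :
  is_total_fraction_ring phi -> left_fraction phi P Nt Dt ->
  graph_splits phi P 1 -> projective_module (col_module (row_mx Nt Dt)).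
Proof.
move=> F_frac [Dt_nz PE] [Q [GQ QG]].
have phi_inj := total_fraction_inj F_frac.
have Dt_unit : map_mx phi Dt \in unitmx.
  by rewrite unitmxE det_map_mx; apply: total_fraction_unit.
have WE : map_mx phi (row_mx Nt Dt) = map_mx phi Dt *m row_mx P 1%:M.
  by rewrite mul_mx_row mulmx1 PE mulKVmx // map_row_mx.
set W := row_mx Nt Dt in WE *.
move: GQ QG; rewrite -[Q]submxK block_mxEv col_mxKd map_row_mx -block_mxEv.
rewrite map_block_mx mul_col_mx mul1mx mul_mx_row [LHS]block_mxEv.
case/eq_block_mx => PQl PQr _ _; rewrite mul_row_col mulmx1 rmorph1 => QG.
pose Q' : 'M[A]_(m + n) := block_mx (1%:M - drsubmx Q) (dlsubmx Q)
                                    (ursubmx Q) (1%:M - ulsubmx Q).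
apply/projective_spanP; exists Q'^T; split=> [i|c].
  have WQ : W *m Q' = W.
    apply: (inj_map_mx phi_inj); rewrite map_mxM WE -mulmxA; congr (_ *m _).
    rewrite map_block_mx mul_row_block !mul1mx !map_mxB !map_mx1 mulmxBr mulmx1.
    by rewrite PQl PQr subrK [X in row_mx _ X]addrC subrK.
  have <- : col i (W *m Q') = col i W by rewrite WQ.
  rewrite [RHS]colE -mulmxA -colE -[col i Q']trmxK -mulmx_sum_col.
  by apply: eq_bigr => j _; rewrite !mxE.
rewrite mulmx_sum_col => Wc; apply: trmx_inj; rewrite trmx_mul trmxK trmx0.
apply: (inj_map_mx phi_inj); rewrite map_mxM map_mx0.
have : row_mx P 1%:M *m map_mx phi c^T = 0.
  apply: (can_inj (mulKmx Dt_unit)).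
  by rewrite mulmxA -WE -map_mxM Wc map_mx0 mulmx0.
rewrite -[c^T]vsubmxK map_col_mx mul_row_col mul1mx => /eqP.
rewrite addrC addr_eq0 => /eqP ->.
rewrite map_block_mx mul_block_col !map_mxB map_mx1 -PQl -PQr.
rewrite !mulmxN !mulmxA -!mulNmx -!mulmxDl.
have dE : map_mx phi (drsubmx Q) = 1%:M - map_mx phi (dlsubmx Q) *m P.
  by rewrite -QG addrC addKr.
rewrite dE subKr !mulNmx subrr mul0mx mulmxBr mulmx1 map_mx1.
by rewrite [(1%:M - _) *m P]mulmxBl mul1mx mulmxA subrr mul0mx col_mx0.
Qed.

(** * Projections and generalized elementary factors *)

Lemma selection_mxE (A : comNzRingType) (n m : nat) (x0 : 'I_(n + m))
    (I : {set 'I_(n + m)}) :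
  #|I| = m -> selection_mx A I = rowsub (set_item x0 I) 1%:M.
Proof.
move=> cI; apply/matrixP => k j; rewrite !mxE /set_item.
have k_lt : (k < size (enum I))%N by rewrite -cardE cI.
by rewrite onthE (nth_map x0) // (inj_eq Some_inj).
Qed.

Lemma gen_elementary_factor_ideal (A : comNzRingType) (n m : nat)
    (N : 'M[A]_(n, m)) (D : 'M[A]_m) (I : {set 'I_(n + m)}) :
  ideal_axiom (gen_elementary_factor N D I).
Proof.
split=> [|a b [K aT] [L bT]|a b [K bT]].
- by exists 0; rewrite !mul0mx scale0r.
- by exists (K + L); rewrite !mulmxDl scalerDl aT bT.
- by exists (a *: K); rewrite -!scalemxAl -scalerA bT.
Qed.

(** Where [a] is invertible, the rows of [T := col_mx N D] in [I] generate all
    of them, and if [E] selects these rows and [a *: T = K *m E *m T], then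
    [K *m E] divided by [a] is a projection onto the graph.  Without dividing,
    [scalar_mulmxC] costs a power of [a], whence the exponent. *)
Lemma gen_elementary_factor_splits (A : comNzRingType) (F : comUnitRingType)
    (phi : {rmorphism A -> F}) (n m : nat) (P : 'M[F]_(n, m))
    (N : 'M[A]_(n, m)) (D : 'M[A]_m) (I : {set 'I_(n + m)}) (a : A) :
  is_total_fraction_ring phi -> right_fraction phi P N D ->
  gen_elementary_factor N D I a -> graph_splits phi P (a ^+ m.+2).
Proof.
move=> F_frac P_right [K].
have [D_unit TE] := graph_fraction F_frac P_right.
set T := col_mx N D in TE *; set E := selection_mx A I => aT.
pose S := map_mx phi E *m graph_mx P.
have aG : phi a *: graph_mx P = map_mx phi K *m S.
  apply: (can_inj (mulmxK D_unit)); rewrite -scalemxAl -TE -map_mxZ aT !map_mxM.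
  by rewrite TE !mulmxA.
have KS : map_mx phi (dsubmx K) *m S = (phi a)%:M.
  have := congr1 dsubmx aG; rewrite linearZ /= col_mxKd scale_scalar_mx mulr1.
  by rewrite -mul_dsub_mx -map_dsubmx.
have SK := scalar_mulmxC KS.
exists (a ^+ m.+1 *: (K *m E)).
rewrite linearZ /= -mul_dsub_mx !map_mxZ !map_mxM -scalemxAr -scalemxAl.
split; last by rewrite -mulmxA KS scale_scalar_mx rmorphXn -exprSr rmorphXn.
rewrite rmorphXn [in LHS]exprSr -[LHS]scalerA.
rewrite [phi a *: (graph_mx P *m _)]scalemxAl aG mulmxA -[_ *m S *m _]mulmxA.
rewrite [LHS]scalemxAl [_ *: (_ *m (S *m _))]scalemxAr SK mul_mx_scalar.
by rewrite -scalemxAl.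
Qed.

Lemma ideal_sum_splits (A : comNzRingType) (F : comUnitRingType)
    (phi : {rmorphism A -> F}) (n m : nat) (P : 'M[F]_(n, m))
    (N : 'M[A]_(n, m)) (D : 'M[A]_m) (S : {pred {set 'I_(n + m)}}) :
  is_total_fraction_ring phi -> right_fraction phi P N D ->
  ideal_sum S (gen_elementary_factor N D) 1 -> graph_splits phi P 1.
Proof.
move=> F_frac P_right [l [lL suml]].
apply: (ideal1_of_powers (S := fun I => I \in S) (l := l) (k := m.+2)) => //.
  exact: graph_splits_ideal.
by move=> I SI; apply: gen_elementary_factor_splits (lL _ SI).
Qed.

(** A principal minor of the projection is the product of the [I]-minors of
    [graph_mx P] and of its left inverse; where it is invertible, the rows
    of [col_mx N D] in [I] are a basis of the row module.  Clearing this
    inverse costs the exponent, by [scalar_mulmxC]. *)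
Lemma principal_minor_gen_elementary_factor (A : comNzRingType)
    (F : comUnitRingType) (phi : {rmorphism A -> F}) (n m : nat)
    (P : 'M[F]_(n, m)) (N : 'M[A]_(n, m)) (D : 'M[A]_m)
    (x0 : 'I_(n + m)) (I : {set 'I_(n + m)}) (Q : 'M[A]_(n + m)) :
  is_total_fraction_ring phi -> right_fraction phi P N D -> #|I| = m ->
  graph_mx P *m map_mx phi (dsubmx Q) = map_mx phi Q ->
  let e : 'I_m -> 'I_(n + m) := set_item x0 I in
  gen_elementary_factor N D I (\det (mxsub e e Q) ^+ m.+1).
Proof.
move=> F_frac P_right cI GQ e; set l := \det _.
have [D_unit TE] := graph_fraction F_frac P_right.
exists (l ^+ m *: (colsub e Q *m \adj (mxsub e e Q))).
rewrite (selection_mxE _ x0 cI) -mulmxA -rowsubE -/e.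
apply: (inj_map_mx (total_fraction_inj F_frac)).
pose S := rowsub e (graph_mx P); pose M := colsub e (map_mx phi (dsubmx Q)).
have SM : map_mx phi (mxsub e e Q) = S *m M by rewrite map_mxsub -GQ mxsub_mul.
have GM : map_mx phi (colsub e Q) = graph_mx P *m M.
  by rewrite map_mxsub -GQ mulmx_colsub.
have SMa : S *m (M *m \adj (S *m M)) = (phi l)%:M.
  by rewrite mulmxA mul_mx_adj -SM det_map_mx.
rewrite -scalemxAl !map_mxZ map_mxM map_mxM GM map_mx_adj SM map_mxsub TE.
rewrite -mul_rowsub_mx -/S !rmorphXn -!mulmxA.
rewrite [M *m (_ *m (S *m _))]mulmxA [M *m _ *m (S *m _)]mulmxA.
rewrite [RHS]scalemxAr [_ *: (M *m _ *m S *m _)]scalemxAl (scalar_mulmxC SMa).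
by rewrite mul_scalar_mx -scalemxAr.
Qed.

(** The Cauchy-Binet formula, applied to the left inverse times [graph_mx P],
    writes 1 as the sum of the principal [m]-minors of the projection. *)
Lemma splits_ideal_sum (A : comNzRingType) (F : comUnitRingType)
    (phi : {rmorphism A -> F}) (n m : nat) (P : 'M[F]_(n, m))
    (N : 'M[A]_(n, m)) (D : 'M[A]_m) :
  is_total_fraction_ring phi -> right_fraction phi P N D -> (0 < n + m)%N ->
  graph_splits phi P 1 ->
  ideal_sum [pred I : {set 'I_(n + m)} | #|I| == m]
    (gen_elementary_factor N D) 1.
Proof.
move=> F_frac P_right nm_gt0 [Q [GQ QG]]; pose x0 := Ordinal nm_gt0.
have sum_ideal := ideal_sum_ideal [pred I : {set 'I_(n + m)} | #|I| == m]
  (gen_elementary_factor_ideal N D).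
pose l I := \det (mxsub (@set_item _ m x0 I) (@set_item _ m x0 I) Q).
apply (@ideal1_of_powers _ _ _ (fun I : {set _} => #|I| == m) l m.+1 sum_ideal).
  apply: (total_fraction_inj F_frac); rewrite rmorph1 -(det1 F m).
  rewrite -[1%:M in RHS](congr1 _ (rmorph1 phi)) -QG (cauchy_binet x0) rmorph_sum /=.
  apply: eq_bigr => I _; rewrite mulrC -det_mulmx -mxsub_mul GQ.
  by rewrite -det_map_mx map_mxsub.
move=> I cI; apply: (ideal_sum_sub (gen_elementary_factor_ideal N D) cI).
by apply: principal_minor_gen_elementary_factor GQ => //; apply/eqP.
Qed.

(** * The equivalence *)

Theorem theorem3p3 (A : comNzRingType) (F : comUnitRingType)
    (phi : {rmorphism A -> F}) (F_frac : is_total_fraction_ring phi)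
    (Z : prime_idealr A) (Z_zerodiv : forall x : A, zerodivisor x -> x \in Z)
    (n m : nat) (n_gt0 : (0 < n)%N) (m_gt0 : (0 < m)%N)
    (P : 'M[F]_(n, m)) (P_causal : causal phi Z P)
    (N : 'M[A]_(n, m)) (D : 'M[A]_m) (P_right : right_fraction phi P N D)
    (Nt : 'M[A]_(n, m)) (Dt : 'M[A]_n) (P_left : left_fraction phi P Nt Dt) :
  [<-> stabilizable phi P;
       projective_module (row_module (col_mx N D)) /\
       projective_module (col_module (row_mx Nt Dt));
       ideal_sum [pred I : {set 'I_(n + m)} | #|I| == m]
         (gen_elementary_factor N D) = [set: A]%classic ].
Proof.
tfae.
- move=> /stabilizable_splits P_splits; split.
    exact: splits_row_projective P_splits.
  exact: splits_col_projective P_splits.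
- case=> /(row_projective_splits F_frac P_right) P_splits _.
  have one_sum : ideal_sum [pred I : {set 'I_(n + m)} | #|I| == m]
      (gen_elementary_factor N D) 1.
    by apply: splits_ideal_sum P_splits => //; rewrite addn_gt0 n_gt0.
  apply/seteqP; split=> // a _; rewrite -(mulr1 a).
  have [_ _ sumM] := ideal_sum_ideal [pred I : {set 'I_(n + m)} | #|I| == m]
    (gen_elementary_factor_ideal N D).
  exact: sumM.
- move=> sumT; apply: (splits_stabilizable (Z := Z)) => //.
    move=> d dZ; apply: total_fraction_unit => // /Z_zerodiv dZ'.
    by rewrite dZ' in dZ.
  have one_sum : ideal_sum [pred I : {set 'I_(n + m)} | #|I| == m]
      (gen_elementary_factor N D) 1 by rewrite sumT.
  exact: ideal_sum_splits one_sum.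
Qed.
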